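(* Let $X=\{v_1,\dots,v_n\}$ be a finite set with at least three points and a fixed labelling. Then the clustering algorithm \texttt{SiR-Morse} on $X$ is Scale-Invariant and Rich. That is, writing $F(d)$ for the partition returned by \texttt{SiR-Morse} on $(X,d)$: $F(\alpha\cdot d)=F(d)$ for every distance $d$ on $X$ and every $\alpha>0$; and for every partition $\mathcal{P}$ of $X$ there exists a distance $d$ on $X$ with $F(d)=\mathcal{P}$.
   Context: A distance on $X$ is a function $d\colon X\times X\to\mathbb{R}$ with $d(i,j)=d(j,i)\ge 0$ and $d(i,j)=0$ if and only if $i=j$ (no triangle inequality required). Morse clustering. Let $\mathcal{G}=(V,E)$ be a finite graph, $E\subseteq V\times V$, with a preorder $\preceq_E$ on edges and a preorder $\preceq_V$ on vertices ($a\prec b$ means $a\preceq b$ and not $b\preceq a$). Let $E_v=\{(v,w)\in E\}$; a maximal edge at $v$ is an $e\in E_v$ with $f\preceq_E e$ for all $f\in E_v$. The Morse flow is $\Phi\colon V\to V$ with $\Phi(v)=w$ if $(v,w)$ is the unique maximal edge at $v$ and $v\prec_V w$, and $\Phi(v)=v$ otherwise. The Morse clustering is the partition of $V$ into connected components (ignoring directions) of the graph on $V$ with edges $(v,\Phi(v))$ for all $v$ with $\Phi(v)\ne v$. \texttt{SiR-Morse} applied to $(X,d)$ is Morse clustering on the complete graph with vertex set $X$ (edges $(v,w)$ for all $v\neq w$), with $v_i\preceq_V v_j$ iff $i\le j$, and, for edges at the same vertex $v$, $(v,w)\preceq_E(v,t)$ iff $d(v,w)\ge d(v,t)$. *)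

(* Defs.v *)
From mathcomp Require Import all_boot all_order all_algebra.
From mathcomp Require Import reals.

Set Implicit Arguments.
Unset Strict Implicit.
Unset Printing Implicit Defensive.

Import Order.TTheory GRing.Theory Num.Theory.
Local Open Scope ring_scope.

Definition is_distance (R : realType) (X : finType) (d : X -> X -> R) : Prop :=
  (forall x y, d x y = d y x) /\ (forall x y, 0 <= d x y) /\
  (forall x y, d x y = 0 <-> x = y).

Definition scale_dist (R : realType) (X : finType) (a : R) (d : X -> X -> R) :
  X -> X -> R := fun x y => a * d x y.

Definition scale_invariant (R : realType) (X : finType)
    (F : (X -> X -> R) -> {set {set X}}) : Prop :=
  forall d : X -> X -> R, is_distance d ->
  forall a : R, 0 < a -> F (scale_dist a d) = F d.

Definition rich (R : realType) (X : finType)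
    (F : (X -> X -> R) -> {set {set X}}) : Prop :=
  forall P : {set {set X}}, partition P [set: X] ->
  exists d : X -> X -> R, is_distance d /\ F d = P.

Record morse_graph (V : finType) := MorseGraph {
  edges : {set V * V};
  edge_le : rel (V * V);
  vertex_le : rel V;
  edge_le_refl : {in edges, reflexive edge_le};
  edge_le_trans : {in edges & &, transitive edge_le};
  vertex_le_refl : reflexive vertex_le;
  vertex_le_trans : transitive vertex_le
}.

Section Morse.
Variables (V : finType) (G : morse_graph V).

Definition vertex_lt (a b : V) : bool :=
  vertex_le G a b && ~~ vertex_le G b a.

Definition edges_at (v : V) : {set V * V} := [set e in edges G | e.1 == v].

Definition maximal_edges (v : V) : {set V * V} :=
  [set e in edges_at v | [forall f in edges_at v, edge_le G f e]].

Definition morse_flow (v : V) : V :=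
  if [pick w | (maximal_edges v == [set (v, w)]) && vertex_lt v w] is Some w
  then w else v.

Definition flow_edge : rel V :=
  [rel v w | (v != w) && ((morse_flow v == w) || (morse_flow w == v))].

Definition morse_clustering : {set {set V}} :=
  equivalence_partition (connect flow_edge) [set: V].

Lemma morse_clustering_partition : partition morse_clustering [set: V].
Proof.
have flow_sym : symmetric flow_edge by move=> x y; rewrite /flow_edge /= eq_sym orbC.
apply: equivalence_partitionP => x y z _ _ _; split; first exact: connect0.
by move=> xy; exact: (same_connect (sym_connect_sym flow_sym) xy).
Qed.

End Morse.

Section SiRMorse.
Variables (R : realType) (X : finType) (n : nat) (v : n.-tuple X).

Definition complete_edges : {set X * X} := [set e | e.1 != e.2].

(* A nearer target is a greater edge; edges leaving different vertices are
   incomparable. *)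
Definition sir_edge_le (d : X -> X -> R) : rel (X * X) :=
  [rel e f | (e.1 == f.1) && (d f.1 f.2 <= d e.1 e.2)].

Definition label_le : rel X := [rel x y | (index x v <= index y v)%N].

Lemma label_le_tnth (i j : 'I_n) : bijective (tnth v) ->
  label_le (tnth v i) (tnth v j) = (i <= j)%N.
Proof.
move=> /bij_inj v_inj.
have uv : uniq v by apply/tuple_uniqP.
have idx (k : 'I_n) : index (tnth v k) v = k.
  by rewrite (tnth_nth (tnth v k)) index_uniq ?size_tuple.
by rewrite /label_le /= !idx.
Qed.

Lemma sir_edge_le_refl d : {in complete_edges, reflexive (sir_edge_le d)}.
Proof. by move=> e _; rewrite /sir_edge_le /= eqxx lexx. Qed.

Lemma sir_edge_le_trans d :
  {in complete_edges & &, transitive (sir_edge_le d)}.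
Proof.
move=> f e g _ _ _ /andP[/eqP ef dfe] /andP[/eqP fg dgf].
by apply/andP; split; [rewrite ef fg | exact: le_trans dgf dfe].
Qed.

Lemma label_le_refl : reflexive label_le.
Proof. by move=> x; exact: leqnn. Qed.

Lemma label_le_trans : transitive label_le.
Proof. by move=> y x z; exact: leq_trans. Qed.

Definition sir_graph (d : X -> X -> R) : morse_graph X :=
  MorseGraph (@sir_edge_le_refl d) (@sir_edge_le_trans d)
    label_le_refl label_le_trans.

Definition sir_morse (d : X -> X -> R) : {set {set X}} :=
  morse_clustering (sir_graph d).

End SiRMorse.

(* Main.v *)
(** For a partition P, let [block_top x] be the point of largest label in the
    block of x, and put distinct points at distance 1 when they lie in one block
    and one of them is its top, and at distance 2 otherwise. A point that is not
    a top has its top as unique nearest neighbour, so it flows there. A top m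
    does not move: a unique nearest neighbour of larger label would lie outside
    the block of m, hence at distance 2, and then all other points, of which
    there are at least two, would be equally near. So the flow is [block_top],
    and its components are the blocks. *)

Require Import Defs.
From mathcomp Require Import all_boot all_order all_algebra.
From mathcomp Require Import reals.

Set Implicit Arguments.
Unset Strict Implicit.
Unset Printing Implicit Defensive.

Import Order.TTheory GRing.Theory Num.Theory.

Section MorseFlow.
Variable V : finType.
Implicit Types G H : morse_graph V.

Lemma eq_equivalence_partition (r s : rel V) (D : {set V}) :
  r =2 s -> equivalence_partition r D = equivalence_partition s D.
Proof.
by move=> rs; apply: eq_imset => x; apply/setP=> y; rewrite !inE rs.
Qed.

Lemma eq_morse_clustering G H :
  morse_flow G =1 morse_flow H -> morse_clustering G = morse_clustering H.
Proof.
move=> GH; apply/eq_equivalence_partition/eq_connect => x y.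
by rewrite /flow_edge /= !GH.
Qed.

Lemma connect_flow_edge G x : connect (flow_edge G) x (morse_flow G x).
Proof.
have [<-|x_moves] := eqVneq x (morse_flow G x); first exact: connect0.
by apply: connect1; rewrite /flow_edge /= x_moves eqxx.
Qed.

Lemma flow_edge_sym G : symmetric (flow_edge G).
Proof. by move=> x y; rewrite /flow_edge /= eq_sym orbC. Qed.

(** Flow edges never leave a block, so each component lies in one block. Conversely, two points of a
    block are joined through their common image under the flow. *)
Lemma morse_clustering_pblock G (P : {set {set V}}) :
  partition P [set: V] ->
  (forall x, morse_flow G x \in pblock P x) ->
  (forall x y, y \in pblock P x -> morse_flow G x = morse_flow G y) ->
  morse_clustering G = P.
Proof.
move=> partP flow_in flow_eq.
have [/eqP covP tiP _] := and3P partP.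
have mem_cover x : x \in cover P by rewrite covP inE.
have pblockE x y : (y \in pblock P x) = (pblock P x == pblock P y).
  by rewrite eq_pblock.
rewrite -[RHS](equivalence_partition_pblock partP).
apply: eq_equivalence_partition => x y; apply/idP/idP => [xy|xy].
  rewrite pblockE; apply/eqP.
  (* The block of [x] is closed under single flow edges, hence under paths. *)
  have inv : closed (flow_edge G) [pred z | pblock P x == pblock P z].
    apply: (intro_closed (sym_connect_sym (@flow_edge_sym G))) => a b ab.
    rewrite !inE => /eqP ->.
    have /andP[_ /orP[/eqP <-|/eqP <-]] := ab; first by rewrite -pblockE.
    by rewrite eq_sym -pblockE.
  by apply/eqP; move: (closed_connect inv xy); rewrite !inE eqxx => <-.
apply: connect_trans (connect_flow_edge G x) _; rewrite (flow_eq _ _ xy).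
rewrite (sym_connect_sym (@flow_edge_sym G)); exact: connect_flow_edge.
Qed.

End MorseFlow.

Local Open Scope ring_scope.

Section SiRFlow.
Variables (R : realType) (X : finType) (n : nat) (v : n.-tuple X).
Implicit Types d : X -> X -> R.

(** Maximality at [x] compares only edges that leave [x], and there a greater edge means a nearer
    target; so the maximal edges point to the nearest neighbours. *)
Lemma mem_maximal_edges d x w :
  ((x, w) \in maximal_edges (sir_graph v d) x) =
  (x != w) && [forall t, (x != t) ==> (d x w <= d x t)].
Proof.
rewrite !inE /= eqxx andbT; congr (_ && _).
apply/forallP/forallP => [max_w t|min_w [y t]]; apply/implyP.
  move=> xt; have := max_w (x, t).
  by rewrite !inE /= xt !eqxx => /andP[].
rewrite !inE /= => /andP[yt /eqP yx]; subst y.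
by rewrite /sir_edge_le /= eqxx (implyP (min_w t)).
Qed.

Lemma maximal_edges_source d x e :
  e \in maximal_edges (sir_graph v d) x -> e.1 = x.
Proof. by rewrite !inE => /andP[/andP[_ /eqP]]. Qed.

Lemma sir_flow_nearest d x w :
  x != w -> (forall t, x != t -> t != w -> d x w < d x t) ->
  (index x v < index w v)%N -> morse_flow (sir_graph v d) x = w.
Proof.
move=> xw near_w lt_xw.
have maxE : maximal_edges (sir_graph v d) x = [set (x, w)].
  apply/setP=> -[y t]; rewrite in_set1; apply/idP/eqP => [yt|[-> ->]].
    have /= yx := maximal_edges_source yt; subst y.
    move: yt; rewrite mem_maximal_edges => /andP[xt /forallP/(_ w)].
    rewrite xw /= => le_tw.
    have [->//|tw] := eqVneq t w.
    by have := lt_le_trans (near_w t xt tw) le_tw; rewrite ltxx.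
  rewrite mem_maximal_edges xw; apply/forallP=> u; apply/implyP=> xu.
  by have [->//|uw] := eqVneq u w; rewrite ltW ?near_w.
rewrite /morse_flow; case: pickP => [z|/(_ w)].
  rewrite maxE => /andP[/eqP eq_xz _].
  by have := set11 (x, z); rewrite -eq_xz in_set1 => /eqP[].
by rewrite maxE eqxx /vertex_lt /= -ltnNge lt_xw andbT /label_le /= ltnW.
Qed.

(** If [x] moved to [w], then a rival [t] at least as near would give a second maximal edge, against
    uniqueness. *)
Lemma sir_flow_fixed d x :
  (forall w, x != w -> (index x v < index w v)%N ->
     exists t, [/\ x != t, t != w & d x t <= d x w]) ->
  morse_flow (sir_graph v d) x = x.
Proof.
move=> others; rewrite /morse_flow; case: pickP => // w /andP[/eqP maxE].
rewrite /vertex_lt /= -ltnNge => /andP[_ lt_xw].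
have : (x, w) \in maximal_edges (sir_graph v d) x by rewrite maxE set11.
rewrite mem_maximal_edges => /andP[xw /forallP min_w].
have [t [xt tw le_tw]] := others w xw lt_xw.
have : (x, t) \in maximal_edges (sir_graph v d) x.
  rewrite mem_maximal_edges xt; apply/forallP=> u; apply/implyP=> xu.
  exact: le_trans le_tw (implyP (min_w u) xu).
by rewrite maxE in_set1 xpair_eqE (negPf tw) andbF.
Qed.

(** The flow sees distances only through comparisons, which a positive factor preserves. *)
Lemma sir_morse_scale_invariant : scale_invariant (@sir_morse R X n v).
Proof.
move=> d _ a a_gt0; apply: eq_morse_clustering => x.
have maxE : maximal_edges (sir_graph v (scale_dist a d)) x
          = maximal_edges (sir_graph v d) x.
  apply/setP=> e; rewrite !inE; congr (_ && _); apply: eq_forallb => f.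
  by rewrite /= /sir_edge_le /scale_dist /= ler_pM2l.
by rewrite /morse_flow maxE.
Qed.

End SiRFlow.

Section Richness.
Variables (R : realType) (X : finType) (n : nat) (v : n.-tuple X).
Hypotheses (v_bij : bijective (tnth v)) (n_ge3 : (2 < n)%N).
Variable P : {set {set X}}.
Hypothesis partP : partition P [set: X].

Lemma index_tuple_inj : injective (fun x => index x v).
Proof.
have [g _ gK] := v_bij => x y /= eq_xy.
have mem z : z \in v by rewrite -[z]gK mem_tnth.
by rewrite -(nth_index x (mem x)) eq_xy nth_index.
Qed.

(** This is where three points are needed: it supplies the rival that keeps a top from moving. *)
Lemma third_point (x y : X) : exists t, (x != t) && (t != y).
Proof.
have cardX : #|X| = n by rewrite -(bij_eq_card v_bij) card_ord.
have : (0 < #|~: [set x; y]|)%N.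
  have := cardsC [set x; y]; rewrite cardX cards2 => eq_n.
  rewrite lt0n; apply/eqP => c0; move: n_ge3; rewrite -eq_n c0 addn0.
  by case: (x != y).
by case/card_gt0P=> t; rewrite !inE negb_or eq_sym => ?; exists t.
Qed.

Let mem_pblockxx x : x \in pblock P x.
Proof. by rewrite mem_pblock (cover_partition partP) inE. Qed.

Let pblock_eq x y : y \in pblock P x -> pblock P x = pblock P y.
Proof. by move=> xy; apply/esym/same_pblock => //; case/and3P: partP. Qed.

Definition block_top (x : X) : X :=
  [arg max_(y > x in pblock P x) index y v].

Lemma block_top_in x : block_top x \in pblock P x.
Proof. by rewrite /block_top; case: arg_maxnP. Qed.

Lemma index_block_top x y :
  y \in pblock P x -> (index y v <= index (block_top x) v)%N.
Proof. by rewrite /block_top; case: arg_maxnP => // z _; apply. Qed.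

(** Both tops maximize the label over the same block, and labels are injective. *)
Lemma block_top_eq x y : y \in pblock P x -> block_top x = block_top y.
Proof.
move=> /pblock_eq xy; apply: index_tuple_inj; apply/eqP; rewrite eqn_leq.
apply/andP; split; apply: index_block_top; first by rewrite -xy block_top_in.
by rewrite xy block_top_in.
Qed.

(** Each block becomes a star centred at its top. No separate test for a common block is needed,
    since [block_top x] lies in the block of [x]. *)
Definition star_dist (x y : X) : R :=
  if x == y then 0
  else if (y == block_top x) || (x == block_top y) then 1 else 2.

Lemma star_dist_is_distance : is_distance star_dist.
Proof.
split; [|split] => x y; rewrite /star_dist.
- by rewrite eq_sym orbC.
- by case: eqP => // _; case: ifP.
- case: eqP => // xy; split=> // /eqP.
  by case: ifP => _; rewrite ?oner_eq0 ?pnatr_eq0.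
Qed.

Lemma star_dist_le2 x y : star_dist x y <= 2.
Proof.
by rewrite /star_dist; case: eqP => // _; case: ifP => // _; rewrite ler1n.
Qed.

Lemma sir_flow_star_dist x : morse_flow (sir_graph v star_dist) x = block_top x.
Proof.
have [x_top|x_ntop] := eqVneq x (block_top x).
  rewrite -x_top; apply: sir_flow_fixed => w xw lt_xw.
  have [t /andP[xt tw]] := third_point x w.
  exists t; split=> //; rewrite [leRHS]/star_dist (negPf xw) -x_top eq_sym.
  rewrite (negPf xw) /=; case: eqP => [x_top_w|_]; last exact: star_dist_le2.
  (* Were [x] the top of [w], then [w] would be a point of its block with a larger label. *)
  have : w \in pblock P x.
    by rewrite x_top_w -(pblock_eq (block_top_in w)).
  by move/index_block_top; rewrite -x_top leqNgt lt_xw.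
apply: sir_flow_nearest => // [t xt t_ntop|].
  rewrite /star_dist (negPf x_ntop) eqxx /= (negPf xt) (negPf t_ntop) /=.
  (* Distance 1 to [t] would make [x] the top of [t], hence its own top. *)
  case: eqP => [x_top_t|_]; last by rewrite ltr1n.
  case/eqP: x_ntop; rewrite {1}x_top_t; apply: block_top_eq.
  by rewrite x_top_t block_top_in.
rewrite ltn_neqAle index_block_top // andbT.
by apply: contra x_ntop => /eqP/index_tuple_inj <-.
Qed.

Lemma sir_morse_star_dist : sir_morse v star_dist = P.
Proof.
apply: morse_clustering_pblock => // [x|x y xy]; rewrite !sir_flow_star_dist.
  exact: block_top_in.
exact: block_top_eq.
Qed.

End Richness.

Local Close Scope ring_scope.

Theorem theorem14 (R : realType) (X : finType) (n : nat) (v : n.-tuple X)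
    (v_bij : bijective (tnth v)) (n_ge3 : 2 < n) :
  scale_invariant (@sir_morse R X n v) /\ rich (@sir_morse R X n v).
Proof.
split; first exact: sir_morse_scale_invariant.
move=> P partP; exists (star_dist R v P).
by split; [exact: star_dist_is_distance | exact: sir_morse_star_dist].
Qed.
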